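(* Let $q$ be an odd prime power. Let $c\in \mathbb{F}_q$ be such that $c^2-2c+5$ is a non-square in $\mathbb{F}_q$. Consider the homogeneous quadratic polynomials \begin{align*} f_0 &= x^2 + y^2 + z^2 + w^2, \\ f_1 &= xy + yz + zw + c\, wx \end{align*} in $\mathbb{F}_q[x,y,z,w]$. Then each of the $q+1$ distinct $\mathbb{F}_q$-members of the pencil $\langle f_0, f_1 \rangle$ is a smooth quadric surface in $\mathbb{P}^3$.
   Context: The $\mathbb{F}_q$-members of the pencil $\langle f_0,f_1\rangle$ are the quadric surfaces $\{s f_0+t f_1=0\}\subset\mathbb{P}^3$ with $[s:t]\in\mathbb{P}^1(\mathbb{F}_q)$. A hypersurface $\{F=0\}$ is smooth if there is no point over $\overline{\mathbb{F}}_q$ in projective space at which $F$ and all of its first-order partial derivatives vanish. *)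

(* Defs.v *)
From HB Require Import structures.
From mathcomp Require Export all_boot all_order all_algebra all_field.
From mathcomp Require Export boolp classical_sets functions cardinality.
From mathcomp Require Export mpoly.

Set Implicit Arguments.
Unset Strict Implicit.
Unset Printing Implicit Defensive.

Import GRing.Theory.
Local Open Scope ring_scope.
Local Open Scope classical_set_scope.

(* The closed field [K] is an algebraic closure of [F] via [iota]: every element
   of [K] is a root of a monic polynomial with coefficients in [iota F].  Every
   finite field has one, by [countable_algebraic_closure]. *)
Definition algebraic_closure (F : fieldType) (K : closedFieldType)
    (iota : {rmorphism F -> K}) : Prop :=
  integralRange iota.

(* A point [v_0 : ... : v_n] is the set of all its homogeneous coordinate
   vectors, i.e. the orbit of [v] under nonzero scalars. *)
Definition proj_point (K : fieldType) (n : nat) (v : 'rV[K]_n.+1) :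
    set 'rV[K]_n.+1 :=
  [set a *: v | a in [set a : K | a != 0]].

Definition projective_space (K : fieldType) (n : nat) :
    set (set 'rV[K]_n.+1) :=
  [set proj_point v | v in [set v : 'rV[K]_n.+1 | v != 0]].

Definition vanishes_at (K : fieldType) (n : nat) (f : {mpoly K[n.+1]})
    (P : set 'rV[K]_n.+1) : Prop :=
  forall v, P v -> f.@[v 0] = 0.

Section OverTheClosure.
Variables (F : fieldType) (K : closedFieldType) (iota : {rmorphism F -> K}).
Variable n : nat.
Implicit Types f g : {mpoly F[n.+1]}.

(* The locus {f = 0} in P^n(K), for [f] with coefficients in [F]. *)
Definition hypersurface f : set (set 'rV[K]_n.+1) :=
  [set P | projective_space P /\ vanishes_at (map_mpoly iota f) P].

Definition singular_point f (P : set 'rV[K]_n.+1) : Prop :=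
  hypersurface f P /\
  forall i : 'I_n.+1, vanishes_at ((map_mpoly iota f)^`M(i)) P.

Definition smooth_hypersurface f : Prop :=
  ~ exists P, singular_point f P.

Definition smooth_quadric f : Prop :=
  [/\ f != 0, f \is 2.-homog & smooth_hypersurface f].

Definition pencil_form f g (s t : F) : {mpoly F[n.+1]} := s *: f + t *: g.

(* The coefficients [s], [t] range over [F], while the members are compared as
   loci in P^n(K). *)
Definition pencil_members f g : set (set (set 'rV[K]_n.+1)) :=
  [set S | exists s t : F,
     (s, t) != (0, 0) /\ S = hypersurface (pencil_form f g s t)].

End OverTheClosure.

Section Quadrics.
Variable F : fieldType.

Let x : {mpoly F[4]} := 'X_(@Ordinal 4 0 isT).
Let y : {mpoly F[4]} := 'X_(@Ordinal 4 1 isT).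
Let z : {mpoly F[4]} := 'X_(@Ordinal 4 2 isT).
Let w : {mpoly F[4]} := 'X_(@Ordinal 4 3 isT).

Definition f0 : {mpoly F[4]} := x ^+ 2 + y ^+ 2 + z ^+ 2 + w ^+ 2.

Definition f1 (c : F) : {mpoly F[4]} := x * y + y * z + z * w + c *: (w * x).

End Quadrics.

(* Main.v *)
Require Import Defs.
From mathcomp Require Import ring.

(** Smoothness.  The partial derivatives of s f0 + t f1 are four linear forms;
    with S = 2 s their matrix is S I + t N, where N is the weighted adjacency
    matrix of the 4-cycle x - y - z - w - x with weights 1, 1, 1, c.  Its
    determinant is
      S^4 - (c^2 + 3) S^2 t^2 + (c - 1)^2 t^4
        = (S^2 - (c + 1) S t + (c - 1) t^2) (S^2 + (c + 1) S t + (c - 1) t^2),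
    and both quadratic factors have discriminant
      (c + 1)^2 - 4 (c - 1) = c^2 - 2 c + 5
    with respect to S.  This is a non-square, so neither factor has a zero
    (S, t) != (0, 0) over F ([discriminant_neq0]); since 2 is invertible,
    (s, t) != (0, 0) gives (S, t) != (0, 0).  The determinant lies in F and
    stays nonzero in K, so the gradient vanishes only at the origin of K^4
    ([gradient_eq0]) and there is no singular point.  A smooth member is in
    particular a nonzero form.

    Counting.  Rescaling (s, t) does not change the locus, so the members are
    the loci of (a, 1) for a in F and of (1, 0), which makes at most q + 1 of
    them.  For them to be distinct, the locus of s f0 + t f1 must determine
    [s : t].  It contains a point at which f0 and f1 do not both vanish
    ([member_off_base]): on the line z = w = 0 the forms are x^2 + y^2 and x y,
    which have no common zero, while s f0 + t f1 has a zero there because K is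
    algebraically closed.  The values of f0 and f1 at such a point determine
    [s : t]. *)

Set Implicit Arguments.
Unset Strict Implicit.
Unset Printing Implicit Defensive.

Import GRing.Theory.
Local Open Scope ring_scope.
Local Open Scope classical_set_scope.
Local Open Scope card_scope.

Local Notation ix := (@Ordinal 4 0 isT).
Local Notation iy := (@Ordinal 4 1 isT).
Local Notation iz := (@Ordinal 4 2 isT).
Local Notation iw := (@Ordinal 4 3 isT).

(** * Finite sets and linear relations *)

(** Translation by 1 permutes F, so the sum of all elements of F equals itself
    plus #|F|; hence #|F| = 0 in F, and an odd cardinal excludes 2 = 0. *)
Lemma natr2_neq0_of_odd_card (F : finFieldType) :
  odd #|F| -> 2%:R != 0 :> F.
Proof.
move=> oddF; apply/eqP => F2.
have cardF0 : #|F|%:R = 0 :> F.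
  have sumT : \sum_(x : F) x = \sum_(x : F) (x + 1).
    by rewrite [LHS](reindex_inj (addIr 1)).
  move: sumT; rewrite big_split /= sumr_const => sumT.
  by apply: (addrI (\sum_(x : F) x)); rewrite addr0 -sumT.
move: cardF0; rewrite -(odd_double_half #|F|) oddF -muln2 natrD natrM F2.
by rewrite mulr0 addr0 => /eqP; rewrite oner_eq0.
Qed.

Lemma card_eq_II_finType (T : finType) : [set: T] #= `I_#|T|.
Proof.
have -> : `I_#|T| = [set nat_of_ord (enum_rank x) | x in [set: T]].
  apply/seteqP; split=> [k /= ltk|k /= [x _ <-]]; last exact: ltn_ord.
  by exists (enum_val (Ordinal ltk)); rewrite //= enum_valK.
rewrite card_eq_sym; apply: inj_card_eq => x y _ _ /=.
by move/val_inj/enum_rank_inj.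
Qed.

(** The 2 x 2 matrix with rows (s, t) and (s', t') kills a nonzero vector, so
    its determinant vanishes. *)
Lemma proportional_of_common_kernel (R : idomainType) (s t s' t' a b : R) :
    s * a + t * b = 0 -> s' * a + t' * b = 0 -> (a, b) != (0, 0) ->
  s * t' = s' * t.
Proof.
move=> e e' ab0; apply/eqP; rewrite -subr_eq0.
apply: contraNT ab0 => D0; rewrite xpair_eqE.
apply/andP; split; apply/eqP; apply: (mulfI D0); rewrite mulr0.
  transitivity (t' * (s * a + t * b) - t * (s' * a + t' * b)); first by ring.
  by rewrite e e' !mulr0 subrr.
transitivity (s * (s' * a + t' * b) - s' * (s * a + t * b)); first by ring.
by rewrite e e' !mulr0 subrr.
Qed.

(** * The discriminant of the pencil *)

Lemma discriminant_factor (R : comPzRingType) (S t c : R) :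
  S ^+ 4 - (c ^+ 2 + 3%:R) * S ^+ 2 * t ^+ 2 + (c - 1) ^+ 2 * t ^+ 4 =
  (S ^+ 2 - (c + 1) * S * t + (c - 1) * t ^+ 2) *
  (S ^+ 2 + (c + 1) * S * t + (c - 1) * t ^+ 2).
Proof. by ring. Qed.

(** Completing the square: if t != 0, a zero would make (2 S + b t) / t a square
    root of b^2 - 4 (c - 1) = c^2 - 2 c + 5.  Leaving b as any square root of
    (c + 1)^2 covers both factors of the determinant. *)
Lemma quadratic_factor_neq0 (F : fieldType) (c b S t : F) :
    ~ (exists a : F, a ^+ 2 = c ^+ 2 - 2%:R * c + 5%:R) ->
    b ^+ 2 = (c + 1) ^+ 2 -> (S, t) != (0, 0) ->
  S ^+ 2 + b * S * t + (c - 1) * t ^+ 2 != 0.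
Proof.
move=> nsq b2 St0; apply/eqP => q0.
have [t0|tN0] := eqVneq t 0.
  move: q0; rewrite t0 expr0n /= !mulr0 !addr0 => /eqP.
  by rewrite expf_eq0 /= => /eqP S0; rewrite S0 t0 eqxx in St0.
apply: nsq; exists ((2%:R * S + b * t) / t).
apply: (mulIf (expf_neq0 2 tN0)); rewrite -exprMn divfK //.
transitivity (4%:R * (S ^+ 2 + b * S * t + (c - 1) * t ^+ 2)
  + (b ^+ 2 - 4%:R * (c - 1)) * t ^+ 2); first by ring.
by rewrite q0 b2; ring.
Qed.

Lemma discriminant_neq0 (F : fieldType) (c S t : F) :
    ~ (exists a : F, a ^+ 2 = c ^+ 2 - 2%:R * c + 5%:R) -> (S, t) != (0, 0) ->
  S ^+ 4 - (c ^+ 2 + 3%:R) * S ^+ 2 * t ^+ 2 + (c - 1) ^+ 2 * t ^+ 4 != 0.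
Proof.
move=> nsq St0; rewrite discriminant_factor mulf_neq0 //.
  by have := quadratic_factor_neq0 nsq (sqrrN (c + 1)) St0; rewrite !mulNr.
exact: quadratic_factor_neq0.
Qed.

(** Because the 4-cycle is bipartite, with parts {x, z} and {y, w}, eliminating
    one part leaves a symmetric 2 x 2 system S^2 u = t^2 M u for the other.  The
    matrix M is B B^T for one part and B^T B for the other, so both systems have
    the determinant D of the full 4 x 4 system. *)
Lemma gradient_eq0 (K : fieldType) (S t c x y z w : K) :
    S ^+ 4 - (c ^+ 2 + 3%:R) * S ^+ 2 * t ^+ 2 + (c - 1) ^+ 2 * t ^+ 4 != 0 ->
    S * x + t * (y + c * w) = 0 -> S * y + t * (x + z) = 0 ->
    S * z + t * (y + w) = 0 -> S * w + t * (z + c * x) = 0 ->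
  [/\ x = 0, y = 0, z = 0 & w = 0].
Proof.
set D := (D in D != 0) => D0 ex ey ez ew.
(* Cramer's rule for S^2 - t^2 M, where M has rows (a, b) and (b, d). *)
have solve2 a b d u v : (S ^+ 2 - t ^+ 2 * a) * (S ^+ 2 - t ^+ 2 * d)
      - (t ^+ 2 * b) ^+ 2 = D ->
    S ^+ 2 * u = t ^+ 2 * (a * u + b * v) ->
    S ^+ 2 * v = t ^+ 2 * (b * u + d * v) -> u = 0 /\ v = 0.
  move=> defD eu ev; split; apply: (mulfI D0); rewrite mulr0 -defD.
    transitivity ((S ^+ 2 - t ^+ 2 * d) * (S ^+ 2 * u - t ^+ 2 * (a * u + b * v))
      + t ^+ 2 * b * (S ^+ 2 * v - t ^+ 2 * (b * u + d * v))); first by ring.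
    by rewrite eu ev !subrr !mulr0 addr0.
  transitivity ((S ^+ 2 - t ^+ 2 * a) * (S ^+ 2 * v - t ^+ 2 * (b * u + d * v))
    + t ^+ 2 * b * (S ^+ 2 * u - t ^+ 2 * (a * u + b * v))); first by ring.
  by rewrite eu ev !subrr !mulr0 addr0.
have [x0 z0] : x = 0 /\ z = 0.
  apply: (solve2 (c ^+ 2 + 1) (c + 1) 2%:R); first by rewrite /D; ring.
    apply/eqP; rewrite -subr_eq0; apply/eqP.
    transitivity (S * (S * x + t * (y + c * w)) - t * (S * y + t * (x + z))
      - t * c * (S * w + t * (z + c * x))); first by ring.
    by rewrite ex ey ew; ring.
  apply/eqP; rewrite -subr_eq0; apply/eqP.
  transitivity (S * (S * z + t * (y + w)) - t * (S * y + t * (x + z))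
    - t * (S * w + t * (z + c * x))); first by ring.
  by rewrite ey ez ew; ring.
have [y0 w0] : y = 0 /\ w = 0.
  apply: (solve2 2%:R (c + 1) (c ^+ 2 + 1)); first by rewrite /D; ring.
    apply/eqP; rewrite -subr_eq0; apply/eqP.
    transitivity (S * (S * y + t * (x + z)) - t * (S * x + t * (y + c * w))
      - t * (S * z + t * (y + w))); first by ring.
    by rewrite ex ey ez; ring.
  apply/eqP; rewrite -subr_eq0; apply/eqP.
  transitivity (S * (S * w + t * (z + c * x)) - t * (S * z + t * (y + w))
    - t * c * (S * x + t * (y + c * w))); first by ring.
  by rewrite ex ez ew; ring.
by split.
Qed.

(** * Members of the pencil as polynomials *)

Section Pencil.
Variables (F : fieldType) (K : closedFieldType) (iota : {rmorphism F -> K}).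
Variable c : F.
Implicit Types (s t : F) (v : 'I_4 -> K).

Local Notation member s t := (pencil_form (f0 F) (f1 c) s t).

Lemma map_member s t : map_mpoly iota (member s t) =
  iota s *: ('X_ix ^+ 2 + 'X_iy ^+ 2 + 'X_iz ^+ 2 + 'X_iw ^+ 2) +
  iota t *: ('X_ix * 'X_iy + 'X_iy * 'X_iz + 'X_iz * 'X_iw
             + iota c *: ('X_iw * 'X_ix)).
Proof.
have mapX := map_mpolyX iota; have mapZ := map_mpolyZ iota.
rewrite /pencil_form /f0 /f1 rmorphD /= !mapZ !rmorphD /= mapZ.
by rewrite !rmorphXn !rmorphM /= !mapX.
Qed.

Lemma meval_member s t v : (map_mpoly iota (member s t)).@[v] =
  iota s * (v ix ^+ 2 + v iy ^+ 2 + v iz ^+ 2 + v iw ^+ 2) +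
  iota t * (v ix * v iy + v iy * v iz + v iz * v iw + iota c * (v iw * v ix)).
Proof.
by rewrite map_member !(mevalD, mevalZ, rmorphXn, mevalM) /= !mevalXU.
Qed.

Lemma mderivXU (i j : 'I_4) : ('X_j : {mpoly K[4]})^`M(i) = (i == j)%:R.
Proof.
rewrite mderivX mnmE eq_sym; case: eqVneq => [->|_]; last by rewrite scale0r.
by rewrite scale1r -[X in (X - _)%MM]add0m addmK mpolyX0.
Qed.

Lemma meval_mderiv_member s t v i :
  ((map_mpoly iota (member s t))^`M(i)).@[v] =
  [tuple iota (2%:R * s) * v ix + iota t * (v iy + iota c * v iw);
         iota (2%:R * s) * v iy + iota t * (v ix + v iz);
         iota (2%:R * s) * v iz + iota t * (v iy + v iw);
         iota (2%:R * s) * v iw + iota t * (v iz + iota c * v ix)]`_i.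
Proof.
rewrite map_member !expr2 !(mderivD, mderivZ, mderivM, mderivXU).
rewrite !(mevalD, mevalZ, mevalM) !mevalXU !(rmorph_nat (meval v)).
rewrite rmorphM rmorph_nat.
by case: i => [[|[|[|[|//]]]] lti] /=; ring.
Qed.

Lemma member_homog s t : member s t \is 2.-homog.
Proof.
have X1 i : ('X_i : {mpoly F[4]}) \is 1.-homog by rewrite dhomogX /= mdeg1.
have XX i j : ('X_i * 'X_j : {mpoly F[4]}) \is 2.-homog.
  exact: (dhomogM (X1 i) (X1 j)).
by rewrite /pencil_form /f0 /f1 !expr2 !(dhomogD, dhomogZ).
Qed.

(** By homogeneity the vanishing on a whole projective point can be tested on
    one of its coordinate vectors. *)
Lemma hypersurface_proj_point s t (v : 'rV[K]_4) : v != 0 ->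
  hypersurface iota (member s t) (proj_point v) <->
  (map_mpoly iota (member s t)).@[v 0] = 0.
Proof.
move=> v0; split=> [[_ /(_ v) ev]|ev].
  by apply: ev; exists 1; rewrite /= ?oner_eq0 ?scale1r.
split=> [|_ [a _ <-]]; first by exists v.
rewrite -[RHS](mulr0 (a ^+ 2)) -ev !meval_member !mxE; ring.
Qed.

Lemma smooth_member s t :
    2%:R != 0 :> F -> ~ (exists a : F, a ^+ 2 = c ^+ 2 - 2%:R * c + 5%:R) ->
    (s, t) != (0, 0) ->
  smooth_hypersurface iota (member s t).
Proof.
move=> F2 nsq st0 [_ [[[v /= v0 <-] _] dP]].
have grad i : ((map_mpoly iota (member s t))^`M(i)).@[v 0] = 0.
  by apply: dP; exists 1; rewrite /= ?oner_eq0 ?scale1r.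
have St0 : (2%:R * s, t) != (0, 0).
  by apply: contra st0; rewrite !xpair_eqE mulf_eq0 (negPf F2).
have D0 : let S := iota (2%:R * s) in
    S ^+ 4 - (iota c ^+ 2 + 3%:R) * S ^+ 2 * iota t ^+ 2
      + (iota c - 1) ^+ 2 * iota t ^+ 4 != 0.
  have := discriminant_neq0 nsq St0; rewrite -(fmorph_eq0 iota) /=.
  by congr (_ != 0); ring.
have := (grad ix, grad iy, grad iz, grad iw); rewrite !meval_mderiv_member /=.
case=> [[[ex ey] ez] ew].
have [x0 y0 z0 w0] := gradient_eq0 D0 ex ey ez ew.
case/eqP: v0; apply/rowP => i; rewrite mxE.
by case: i => [[|[|[|[|//]]]] lti]; [move: x0|move: y0|move: z0|move: w0];
   move=> <-; congr (v 0 _); apply: val_inj.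
Qed.

Lemma smooth_quadric_member s t :
    2%:R != 0 :> F -> ~ (exists a : F, a ^+ 2 = c ^+ 2 - 2%:R * c + 5%:R) ->
    (s, t) != (0, 0) ->
  smooth_quadric iota (member s t).
Proof.
move=> F2 nsq st0; have sm := smooth_member F2 nsq st0.
split=> //; last exact: member_homog.
(* Every projective point is singular on the zero form. *)
apply/eqP => m0; apply: sm; rewrite m0.
have v0 : const_mx 1 != 0 :> 'rV[K]_4.
  by apply/eqP => /rowP/(_ 0)/eqP; rewrite !mxE oner_eq0.
exists (proj_point (const_mx 1)); split.
  by split=> [|v _]; [exists (const_mx 1)|rewrite rmorph0 meval0].
by move=> i v _; rewrite rmorph0 mderiv0 meval0.
Qed.

(** The witness is (1 : y : 0 : 0), where f0 = 1 + y^2 and f1 = y. *)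
Lemma member_off_base s t : exists v : 'rV[K]_4,
  [/\ v != 0, (map_mpoly iota (member s t)).@[v 0] = 0
    & ((map_mpoly iota (member 1 0)).@[v 0],
       (map_mpoly iota (member 0 1)).@[v 0]) != (0, 0)].
Proof.
have [y ey y_or] : exists2 y : K, iota s * (1 + y ^+ 2) + iota t * y = 0
    & (1 + y ^+ 2, y) != (0, 0).
  have y_or (y : K) : (1 + y ^+ 2, y) != (0, 0).
    rewrite xpair_eqE; have [->|_] := eqVneq y 0; last by rewrite andbF.
    by rewrite expr0n addr0 oner_eq0.
  have [s0|sN0] := eqVneq s 0.
    by exists 0; rewrite // s0 rmorph0 mul0r mulr0 addr0.
  have sK : iota s != 0 by rewrite fmorph_eq0.
  (* y^2 = -1 - (t / s) y is the equation s (1 + y^2) + t y = 0 made monic. *)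
  have [//|y] := @GRing.solve_monicpoly K 2 (nth 0 [:: -1; - (iota t / iota s)]).
  rewrite !big_ord_recr big_ord0 /= => ey; exists y => //.
  by rewrite ey; field.
pose v : 'rV[K]_4 := \row_i [:: 1; y]`_i.
exists v; split.
- by apply/eqP => /rowP/(_ ix)/eqP; rewrite !mxE oner_eq0.
- by rewrite meval_member !mxE /= -[RHS]ey; ring.
suff -> : ((map_mpoly iota (member 1 0)).@[v 0],
       (map_mpoly iota (member 0 1)).@[v 0]) = (1 + y ^+ 2, y) by [].
by rewrite !meval_member !mxE /= rmorph0 rmorph1; congr (_, _); ring.
Qed.

Lemma hypersurface_member_proportional s t s' t' :
    hypersurface iota (member s t) = hypersurface iota (member s' t') ->
  s * t' = s' * t.
Proof.
move=> eqS; have [v [v0 ev]] := member_off_base s t.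
have ev' : (map_mpoly iota (member s' t')).@[v 0] = 0.
  apply/(hypersurface_proj_point _ _ v0); rewrite -eqS.
  exact/hypersurface_proj_point.
move: ev ev'; rewrite !meval_member !rmorph0 !rmorph1 !mul1r !mul0r add0r addr0.
move=> e e' ab0; apply: (fmorph_inj iota); rewrite !rmorphM.
exact: proportional_of_common_kernel e e' ab0.
Qed.

Lemma hypersurface_scale s t a : a != 0 ->
  hypersurface iota (member (a * s) (a * t)) = hypersurface iota (member s t).
Proof.
move=> a0; have aK : iota a != 0 by rewrite fmorph_eq0.
have scale v : (map_mpoly iota (member (a * s) (a * t))).@[v] =
    iota a * (map_mpoly iota (member s t)).@[v].
  by rewrite !meval_member !rmorphM; ring.
apply/seteqP; split=> P [PP vP]; split=> // v Pv; have := vP v Pv.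
  by rewrite scale => /eqP; rewrite mulf_eq0 (negPf aK) => /eqP.
by rewrite scale => ->; rewrite mulr0.
Qed.

(** The projective line over F is [option F]: [Some a] is [a : 1] and [None] is
    the point [1 : 0]. *)
Definition normalized_member (u : option F) : set (set 'rV[K]_4) :=
  hypersurface iota (if u is Some a then member a 1 else member 1 0).

Lemma pencil_membersE :
  pencil_members iota (f0 F) (f1 c) = range normalized_member.
Proof.
apply/seteqP; split=> [_ [s [t [st0 ->]]]|_ [[a|] _ <-]]; last first.
- by exists 1, 0; rewrite xpair_eqE oner_eq0.
- by exists a, 1; rewrite xpair_eqE oner_eq0 andbF.
have [t0|tN0] := eqVneq t 0.
  have sN0 : s != 0 by move: st0; rewrite t0 xpair_eqE eqxx andbT.
  exists None => //=; rewrite /normalized_member -(hypersurface_scale 1 0 sN0).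
  by rewrite mulr1 mulr0 t0.
exists (Some (s / t)) => //; rewrite /normalized_member.
by rewrite -(hypersurface_scale _ _ tN0) mulr1 mulrC divfK.
Qed.

Lemma normalized_member_inj : injective normalized_member.
Proof.
move=> [a|] [b|] //= /hypersurface_member_proportional.
- by rewrite !mulr1 => ->.
- by move/eqP; rewrite mulr0 mulr1 eq_sym oner_eq0.
- by move/eqP; rewrite mulr0 mulr1 oner_eq0.
Qed.

End Pencil.

Theorem proposition3p3
    (F : finFieldType) (q : nat) (q_card : #|F| = q) (q_odd : odd q)
    (K : closedFieldType) (iota : {rmorphism F -> K})
    (K_closure : algebraic_closure iota)
    (c : F) (c_nonsquare : ~ exists a : F, a ^+ 2 = c ^+ 2 - 2%:R * c + 5%:R) :
  pencil_members iota (f0 F) (f1 c) #= `I_(q.+1) /\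
  (forall s t : F, (s, t) != (0, 0) ->
     smooth_quadric iota (pencil_form (f0 F) (f1 c) s t)).
Proof.
split=> [|s t st0].
  rewrite pencil_membersE -q_card -card_option.
  apply: card_eq_trans (card_eq_II_finType (option F)).
  by apply: inj_card_eq => u v _ _; apply: normalized_member_inj.
have F2 : 2%:R != 0 :> F by apply: natr2_neq0_of_odd_card; rewrite q_card.
exact: smooth_quadric_member.
Qed.
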